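(* Let $G$ and $H$ be graphs, and let $G'$ and $H'$ be their respective cores. Then: (1) $\mathrm{C}(G;H)=\mathrm{C}(G';H)=\mathrm{C}(G';H')=\mathrm{C}(G;H')$. (2) $\mathrm{IC}(G';H)\leq\min\{\mathrm{IC}(G;H),\mathrm{IC}(G';H')\}\leq\max\{\mathrm{IC}(G;H),\mathrm{IC}(G';H')\}\leq\mathrm{IC}(G;H')$.
   Context: ''Graph'' means either an undirected graph (loops allowed) or a directed graph (a set of vertices with a binary relation), without multiple edges; all graphs in the statement are of the same kind. A homomorphism $f:G\to H$ is a map $f:V(G)\to V(H)$ with $f(u)f(v)\in E(H)$ whenever $uv\in E(G)$; it is injective if it is injective on vertices and the induced map on edges is injective (the former implies the latter). A subgraph of $G$ is a graph whose vertex and edge sets are subsets of $V(G)$, $E(G)$. The union $G_1\cup\cdots\cup G_k$ has vertex set $\bigcup_i V(G_i)$ and edge set $\bigcup_i E(G_i)$. If $K$ is a subgraph of $G$, a retraction of $G$ to $K$ is a homomorphism $r:G\to K$ with $r(v)=v$ for all $v\in V(K)$; then $K$ is a retract of $G$. A core is a graph which does not retract to a proper subgraph. The core of $G$ is the (unique up to isomorphism) retract of $G$ that is a core. The hom-complexity $\mathrm{C}(G;H)$ is the least positive integer $k$ such that there are subgraphs $G_1,\dots,G_k$ of $G$ with $G=G_1\cup\cdots\cup G_k$ and, for each $i$, a homomorphism $G_i\to H$; $\mathrm{C}(G;H)=\infty$ if no such $k$ exists. The injective hom-complexity $\mathrm{IC}(G;H)$ is defined in the same way, requiring for each $i$ an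 injective homomorphism $G_i\to H$. *)

(* Defs.v *)
From HB Require Import structures.
From mathcomp Require Import all_boot all_order all_algebra.
From mathcomp Require Import boolp classical_sets constructive_ereal.

Set Implicit Arguments.
Unset Strict Implicit.
Unset Printing Implicit Defensive.

Local Open Scope classical_set_scope.

Inductive graph_kind := Undirected | Directed.

(* The edge uv of an undirected graph is represented by both ordered pairs
   (u, v) and (v, u). Loops are allowed and the vertex set may be empty or
   infinite. *)
Record graph (k : graph_kind) := Graph {
  vertex :> Type;
  edges : set (vertex * vertex);
  edges_sym : k = Undirected ->
    forall u v, edges (u, v) -> edges (v, u)
}.
Arguments edges {k} g _.

(* When do two ordered pairs represent the same edge? *)
Definition same_edge (k : graph_kind) (T : Type) (e e' : T * T) : Prop :=
  e = e' \/ (k = Undirected /\ e = (e'.2, e'.1)).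

Definition edge_map (T U : Type) (f : T -> U) (e : T * T) : U * U :=
  (f e.1, f e.2).

Definition is_hom k (G H : graph k) (f : G -> H) : Prop :=
  forall u v, edges G (u, v) -> edges H (f u, f v).

Definition is_injective_hom k (G H : graph k) (f : G -> H) : Prop :=
  [/\ is_hom f, injective f &
    forall e e', edges G e -> edges G e' ->
      same_edge k (edge_map f e) (edge_map f e') -> same_edge k e e'].

Record subgraph k (G : graph k) := Subgraph {
  sub_vertices : set G;
  sub_edges : set (G * G);
  sub_edges_in : sub_edges `<=` edges G;
  sub_edges_ends : sub_edges `<=` sub_vertices `*` sub_vertices;
  sub_edges_sym : k = Undirected ->
    forall u v, sub_edges (u, v) -> sub_edges (v, u)
}.

Section SubgraphAsGraph.
Variables (k : graph_kind) (G : graph k) (K : subgraph G).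

Let V : Type := set_type (sub_vertices K).
Let E : set (V * V) := [set e | sub_edges K (val e.1, val e.2)].

Let E_sym : k = Undirected -> forall u v, E (u, v) -> E (v, u).
Proof. by move=> hk u v; apply: (sub_edges_sym hk). Qed.

Definition graph_of_subgraph : graph k := Graph E_sym.
End SubgraphAsGraph.

Coercion graph_of_subgraph : subgraph >-> graph.

Definition proper_subgraph k (G : graph k) (K : subgraph G) : Prop :=
  ~ (sub_vertices K = setT /\ sub_edges K = edges G).

Definition is_retraction k (G : graph k) (K : subgraph G) (r : G -> K) : Prop :=
  is_hom r /\ forall v : K, r (val v) = v.

Definition is_retract k (G : graph k) (K : subgraph G) : Prop :=
  exists r : G -> K, is_retraction r.

Definition is_core k (G : graph k) : Prop :=
  forall K : subgraph G, proper_subgraph K -> ~ is_retract K.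

Definition is_core_of k (G : graph k) (K : subgraph G) : Prop :=
  is_retract K /\ is_core K.

Definition is_union k (G : graph k) n (F : 'I_n -> subgraph G) : Prop :=
  setT = \bigcup_i sub_vertices (F i) /\ edges G = \bigcup_i sub_edges (F i).

Definition hom_cover k (G H : graph k) (n : nat) : Prop :=
  exists F : 'I_n -> subgraph G,
    is_union F /\ forall i, exists f : F i -> H, is_hom f.

Definition injective_hom_cover k (G H : graph k) (n : nat) : Prop :=
  exists F : 'I_n -> subgraph G,
    is_union F /\ forall i, exists f : F i -> H, is_injective_hom f.

(* Values in N with infinity are taken in the extended integers \bar int;
   -oo never occurs. *)
Definition least_positive (P : nat -> Prop) : \bar int :=
  if pselect (exists n, (0 < n)%N && `[< P n >]) is left ex
  then ((ex_minn ex)%:Z)%:E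
  else +oo%E.

Definition hom_complexity k (G H : graph k) : \bar int :=
  least_positive (hom_cover G H).

Definition injective_hom_complexity k (G H : graph k) : \bar int :=
  least_positive (injective_hom_cover G H).

(* Main.v *)
(** Covers pull back along homomorphisms of the source graph (the preimage of a
    subgraph maps to that subgraph) and push forward along homomorphisms of the
    target graph; a core is connected to its graph by homomorphisms in both
    directions, namely the inclusion, which is injective, and the retraction. *)

Require Import Defs.
From mathcomp Require Import all_boot all_order all_algebra.
From mathcomp Require Import boolp classical_sets constructive_ereal.

Set Implicit Arguments.
Unset Strict Implicit.
Unset Printing Implicit Defensive.

Import Order.TTheory.
Local Open Scope ereal_scope.

Section Covers.
Local Open Scope classical_set_scope.

(** Injectivity on edges follows from injectivity on vertices: whether two image pairs agree
    directly or after a swap, [injective f] cancels [f] in each coordinate. *)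
Lemma is_injective_homP k (G H : graph k) (f : G -> H) :
  is_injective_hom f <-> is_hom f /\ injective f.
Proof.
split=> [[homf injf _]|[homf injf]]; first by split.
split=> // -[a b] [c d] _ _ [|[hk]] [/injf-> /injf->]; first by left.
by right.
Qed.

Lemma is_hom_comp k (G H K : graph k) (g : H -> K) (f : G -> H) :
  is_hom g -> is_hom f -> is_hom (g \o f).
Proof. by move=> homg homf u v /homf/homg. Qed.

Lemma is_injective_hom_comp k (G H K : graph k) (g : H -> K) (f : G -> H) :
  is_injective_hom g -> is_injective_hom f -> is_injective_hom (g \o f).
Proof.
move=> /is_injective_homP[homg injg] /is_injective_homP[homf injf].
apply/is_injective_homP; split; first exact: is_hom_comp.
exact: inj_comp.
Qed.

Lemma val_is_injective_hom k (G : graph k) (K : subgraph G) :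
  is_injective_hom (val : K -> G).
Proof.
apply/is_injective_homP; split; last exact: val_inj.
by move=> u v; apply: sub_edges_in.
Qed.

Section Preimage.
Variables (k : graph_kind) (G H : graph k) (f : G -> H) (K : subgraph H).

Let V := f @^-1` sub_vertices K.
(** The intersection with [edges G] discards pairs that [f] sends to an edge of [K] although they
    are not edges of [G]. *)
Let E := edges G `&` edge_map f @^-1` sub_edges K.

Let E_in : E `<=` edges G. Proof. by move=> e []. Qed.

Let E_ends : E `<=` V `*` V.
Proof. by move=> e [_ /sub_edges_ends]. Qed.

Let E_sym : k = Undirected -> forall u v, E (u, v) -> E (v, u).
Proof.
by move=> hk u v [/(edges_sym hk) Gvu /(sub_edges_sym hk) Kvu].
Qed.

Definition preimage_subgraph : subgraph G := Subgraph E_in E_ends E_sym.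

Lemma preimage_subgraph_mem (v : preimage_subgraph) :
  f (val v) \in sub_vertices K.
Proof. exact/mem_set/(set_mem (valP v)). Qed.

Definition preimage_map (v : preimage_subgraph) : K :=
  exist _ (f (val v)) (preimage_subgraph_mem v).

Lemma preimage_map_is_hom : is_hom preimage_map.
Proof. by move=> u v []. Qed.

Lemma preimage_map_inj : injective f -> injective preimage_map.
Proof. by move=> injf u v /(congr1 val)/injf/val_inj. Qed.
End Preimage.

(** Preimages of a vertex cover form a vertex cover for any map; [is_hom f] serves the edges, since
    it puts the image of each edge of [G] inside some [F i]. *)
Lemma preimage_is_union k (G H : graph k) (f : G -> H) n
    (F : 'I_n -> subgraph H) :
  is_hom f -> is_union F -> is_union (fun i => preimage_subgraph f (F i)).
Proof.
move=> homf [FV FE]; split.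
  by rewrite -preimage_bigcup -FV preimage_setT.
apply/seteqP; split=> [[u v] Guv|e [i _ []]//].
have := homf _ _ Guv; rewrite FE => -[i _ Fi].
by exists i.
Qed.

Lemma hom_cover_preimage k (G G2 H : graph k) (f : G -> G2) n :
  is_hom f -> hom_cover G2 H n -> hom_cover G H n.
Proof.
move=> homf [F [unF homF]].
exists (fun i => preimage_subgraph f (F i)); split; first exact: preimage_is_union.
move=> i; have [g homg] := homF i; exists (g \o @preimage_map _ _ _ f (F i)).
exact: is_hom_comp homg (@preimage_map_is_hom _ _ _ f (F i)).
Qed.

Lemma injective_hom_cover_preimage k (G G2 H : graph k) (f : G -> G2) n :
  is_injective_hom f -> injective_hom_cover G2 H n -> injective_hom_cover G H n.
Proof.
move=> /is_injective_homP[homf injf] [F [unF homF]].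
exists (fun i => preimage_subgraph f (F i)); split; first exact: preimage_is_union.
move=> i; have [g homg] := homF i; exists (g \o @preimage_map _ _ _ f (F i)).
apply: is_injective_hom_comp homg _; apply/is_injective_homP.
by split; [exact: preimage_map_is_hom|exact: preimage_map_inj].
Qed.

Lemma hom_cover_comp k (G H H2 : graph k) (h : H -> H2) n :
  is_hom h -> hom_cover G H n -> hom_cover G H2 n.
Proof.
move=> homh [F [unF homF]]; exists F; split=> // i.
by have [g homg] := homF i; exists (h \o g); exact: is_hom_comp.
Qed.

Lemma injective_hom_cover_comp k (G H H2 : graph k) (h : H -> H2) n :
  is_injective_hom h -> injective_hom_cover G H n -> injective_hom_cover G H2 n.
Proof.
move=> homh [F [unF homF]]; exists F; split=> // i.
by have [g homg] := homF i; exists (h \o g); exact: is_injective_hom_comp.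
Qed.
End Covers.

(** The least [n] satisfying [Q] is a candidate in the minimum for [P]; if there is none, the
    right-hand side is [+oo]. *)
Lemma le_least_positive (P Q : nat -> Prop) :
  (forall n, Q n -> P n) -> least_positive P <= least_positive Q.
Proof.
move=> QP; rewrite /least_positive.
case: (pselect (exists n, (0 < n)%N && `[< Q n >])) => [exQ|_]; last exact: leey.
case: (ex_minnP exQ) => n /andP[n0 /asboolP/QP Pn] _.
have Pn' : (0 < n)%N && `[< P n >] by rewrite n0; apply/asboolP.
case: pselect => [exP|[]]; last by exists n.
by case: (ex_minnP exP) => m _ /(_ _ Pn'); rewrite lee_fin.
Qed.

(** Complexity is invariant under homomorphic equivalence in both arguments: a cover is pulled back
    along the source map and its homomorphisms are extended along the target map, with the number of
    pieces unchanged. *)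
Lemma eq_hom_complexity k (G G2 H H2 : graph k)
    (f : G -> G2) (f2 : G2 -> G) (h : H -> H2) (h2 : H2 -> H) :
  is_hom f -> is_hom f2 -> is_hom h -> is_hom h2 ->
  hom_complexity G H = hom_complexity G2 H2.
Proof.
move=> homf homf2 homh homh2; apply: le_anti; apply/andP.
split; apply: le_least_positive => n.
  by move=> /(hom_cover_preimage homf)/(hom_cover_comp homh2).
by move=> /(hom_cover_preimage homf2)/(hom_cover_comp homh).
Qed.

Theorem proposition3p12 (k : graph_kind) (G H : graph k)
    (G' : subgraph G) (H' : subgraph H)
    (coreG : is_core_of G') (coreH : is_core_of H') :
  [/\ hom_complexity G H = hom_complexity G' H,
      hom_complexity G' H = hom_complexity G' H' &
      hom_complexity G' H' = hom_complexity G H'] /\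
  [/\ injective_hom_complexity G' H <=
        mine (injective_hom_complexity G H) (injective_hom_complexity G' H'),
      mine (injective_hom_complexity G H) (injective_hom_complexity G' H') <=
        maxe (injective_hom_complexity G H) (injective_hom_complexity G' H') &
      maxe (injective_hom_complexity G H) (injective_hom_complexity G' H') <=
        injective_hom_complexity G H'].
Proof.
have [[[r [homr _]] _] [[s [homs _]] _]] := (coreG, coreH).
have injG := val_is_injective_hom G'; have injH := val_is_injective_hom H'.
have /is_injective_homP[homG _] := injG; have /is_injective_homP[homH _] := injH.
have homid (K : graph k) : is_hom (@id K) by [].
(* Each equality changes one argument only: inclusion and retraction serve there, the identity on
   the other side. *)
split; first by split; apply: eq_hom_complexity; eassumption || exact: homid.
(* Retractions need not be injective, so only the inclusions act on injective covers, which gives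
   inequalities in one direction. [leG] and [leH] are each used twice, once for each choice of the
   other argument. *)
have leG (K : graph k) :
    injective_hom_complexity G' K <= injective_hom_complexity G K.
  by apply: le_least_positive => n; apply: injective_hom_cover_preimage injG.
have leH (K : graph k) :
    injective_hom_complexity K H <= injective_hom_complexity K H'.
  by apply: le_least_positive => n; apply: injective_hom_cover_comp injH.
split; first by rewrite le_min leG leH.
  by rewrite le_max !ge_min lexx.
by rewrite ge_max leG leH.
Qed.
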